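(* Let $\nu>0$ and assume $f\in C^{1,1}_\nu(\mathbb{R}^2)$. Let $\Theta=\{\mathbf{x}_1,\mathbf{x}_2,\mathbf{x}_3\}\subset\mathbb{R}^2$ be a fixed set of affinely independent vectors such that $(\mathbf{x}_2-\mathbf{x}_1)\cdot(\mathbf{x}_3-\mathbf{x}_1)<0$. Let $\hat f$ be the affine function that interpolates $f$ on $\Theta$. Let $\mathbf{x}_0\in\mathbb{R}^2$ be a fixed point such that $\ell_2(\mathbf{x}_0)>0$, $\ell_3(\mathbf{x}_0)<0$, and $$\ell_1(\mathbf{x}_0)\,[\mathbf{x}_2-\mathbf{x}_1]\cdot[\mathbf{x}_3-\mathbf{x}_1]-\ell_3(\mathbf{x}_0)\,[\mathbf{x}_2-\mathbf{x}_3]\cdot[\mathbf{x}_1-\mathbf{x}_3]<0 .$$ Let $G=\sum_{i=0}^{3}\ell_i(\mathbf{x}_0)\mathbf{x}_i\mathbf{x}_i^T$ and $$\tilde H^\star=\tilde P\begin{bmatrix}\nu&0\\0&-\nu\end{bmatrix}\tilde P^{-1},\qquad \tilde P=\begin{bmatrix}\mathbf{x}_2-\mathbf{x}_0&\mathbf{x}_1-\mathbf{x}_3\end{bmatrix}\in\mathbb{R}^{2\times2}.$$ Then $$|\hat f(\mathbf{x}_0)-f(\mathbf{x}_0)|\le\frac12\,G\cdot\tilde H^\star .$$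
   Context: $C^{1,1}_\nu(\mathbb{R}^2)$ is the class of continuously differentiable functions $f:\mathbb{R}^2\to\mathbb{R}$ with $\|Df(\mathbf{u})-Df(\mathbf{v})\|\le\nu\|\mathbf{u}-\mathbf{v}\|$ for all $\mathbf{u},\mathbf{v}\in\mathbb{R}^2$ (Euclidean norms). $\hat f$ is the unique affine function with $\hat f(\mathbf{x}_i)=f(\mathbf{x}_i)$, $i=1,2,3$. For $i=1,2,3$, $\ell_i$ is the Lagrange polynomial of $\Theta$: the unique affine function with $\ell_i(\mathbf{x}_j)=1$ if $j=i$ and $0$ if $j\ne i$ ($j=1,2,3$); additionally $\ell_0\equiv-1$. The dot product of two matrices of the same size is the sum of entrywise products, $A\cdot B=\mathrm{Tr}(A^TB)$. The points of $\Theta$ are not assumed to be ordered by the values $\ell_i(\mathbf{x}_0)$. (The matrix $\tilde P$ is invertible under the stated hypotheses.) *)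

(* Defs.v *)
From HB Require Import structures.
From mathcomp Require Import all_boot all_order all_algebra.
From mathcomp Require Import all_classical all_reals all_analysis.
Set Implicit Arguments.
Unset Strict Implicit.
Unset Printing Implicit Defensive.
Import Order.TTheory GRing.Theory Num.Theory.
Import numFieldNormedType.Exports.
Local Open Scope classical_set_scope.
Local Open Scope ring_scope.

(* On column vectors ([n = 1]) this is the usual dot product. *)
Definition mxdot (R : realType) (m n : nat) (A B : 'M[R]_(m, n)) : R :=
  \tr (A^T *m B).

(* The library norm [`|u|] on matrices is the sup norm; it induces the same
   topology, hence the same differentiability and continuity, but the
   Lipschitz condition below needs the Euclidean norm. *)
Definition enorm (R : realType) (n : nat) (u : 'cV[R]_n) : R :=
  Num.sqrt (mxdot u u).

Definition gradient (R : realType) (n : nat) (f : 'cV[R]_n.+1 -> R)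
    (u : 'cV[R]_n.+1) : 'cV[R]_n.+1 :=
  \col_i 'D_(delta_mx i 0) f u.

Definition C11 (R : realType) (n : nat) (nu : R) (f : 'cV[R]_n.+1 -> R) : Prop :=
  [/\ forall u, differentiable f u,
      continuous (gradient f)
    & forall u v, enorm (gradient f u - gradient f v) <= nu * enorm (u - v)].

Definition affine_function (R : realType) (n : nat) (g : 'cV[R]_n -> R) : Prop :=
  exists (c : R) (a : 'cV[R]_n), forall u, g u = c + mxdot a u.

(* A family [x : 'I_4 -> 'cV_2] lists the evaluation point [x 0] followed by
   the sample points [x 1], [x 2], [x 3]. *)

Definition affinely_independent (R : realType) (x : 'I_4 -> 'cV[R]_2) : Prop :=
  free [:: x 2 - x 1; x 3 - x 1].

Definition affine_interpolant (R : realType) (x : 'I_4 -> 'cV[R]_2)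
    (f fhat : 'cV[R]_2 -> R) : Prop :=
  affine_function fhat /\ forall i, i != 0 -> fhat (x i) = f (x i).

Definition lagrange_family (R : realType) (x : 'I_4 -> 'cV[R]_2)
    (ell : 'I_4 -> 'cV[R]_2 -> R) : Prop :=
  (forall u, ell 0 u = -1) /\
  (forall i, i != 0 -> affine_function (ell i) /\
     forall j, j != 0 -> ell i (x j) = (j == i)%:R).

Definition Gmx (R : realType) (x : 'I_4 -> 'cV[R]_2)
    (ell : 'I_4 -> 'cV[R]_2 -> R) : 'M[R]_2 :=
  \sum_(i < 4) ell i (x 0) *: (x i *m (x i)^T).

Definition Ptilde (R : realType) (x : 'I_4 -> 'cV[R]_2) : 'M[R]_2 :=
  row_mx (x 2 - x 0) (x 1 - x 3).

Definition Htilde (R : realType) (nu : R) (x : 'I_4 -> 'cV[R]_2) : 'M[R]_2 :=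
  Ptilde x *m (block_mx nu%:M 0 0 (- nu)%:M : 'M[R]_(1 + 1))
    *m invmx (Ptilde x).

(* Main.v *)
Require Import Defs.
From mathcomp Require Import all_boot all_order all_algebra.
From mathcomp Require Import all_classical all_reals all_analysis.
From mathcomp Require Import ring lra.
Set Implicit Arguments.
Unset Strict Implicit.
Unset Printing Implicit Defensive.
Import Order.TTheory GRing.Theory Num.Theory.
Import numFieldNormedType.Exports.
Local Open Scope ring_scope.

(** Write [l_i] for the value of the i-th Lagrange polynomial at [x 0]. The
    hypotheses force [0 < l_1] and [l_2 < 1], so that [l_3] is the only
    negative weight in [x 0 = l_1 x 1 + l_2 x 2 + l_3 x 3]. Collecting terms in
    two ways gives one point
      [w = (x 0 - l_2 x 2) / (1 - l_2) = (l_1 x 1 + l_3 x 3) / (l_1 + l_3)],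
    where the line through [x 0] and [x 2] meets the line through [x 1] and
    [x 3]. The point [x 0] lies between [w] and [x 2], and [x 1] lies between
    [w] and [x 3]. The value of [f] at [w] cancels in the decomposition
      [fhat (x 0) - f (x 0) = E_0 - l_1 E_1],
    where [E_0] and [E_1] are the errors of univariate linear interpolation of
    [f] on the segments [[w, x 2]] and [[w, x 3]], taken at [x 0] and [x 1].

    On a segment the interpolation error of a function whose gradient is
    [nu]-Lipschitz is at most [nu / 2 * t * (1 - t)] times the squared length
    ([segment_interpolation_error], a consequence of the usual quadratic bound
    on the Taylor remainder, [descent]). The triangle inequality then bounds
    the error by
      [nu / (2 (1 - l_2)) * (l_2 |x 2 - x 0|^2 - l_1 l_3 |x 1 - x 3|^2)].
    This is exactly the right-hand side of the theorem: the columns of the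
    conjugating matrix are eigenvectors of the conjugate, for [nu] and [- nu],
    and [G] is a combination of the two dyads built on these columns
    ([Gmx_diag], [Gmx_Htilde]). *)

(** * The entrywise dot product *)

Section DotProduct.
Context {R : realType}.

Lemma mxdotDr m n (A B C : 'M[R]_(m, n)) :
  mxdot A (B + C) = mxdot A B + mxdot A C.
Proof. by rewrite /mxdot mulmxDr raddfD. Qed.

Lemma mxdotDl m n (A B C : 'M[R]_(m, n)) :
  mxdot (A + B) C = mxdot A C + mxdot B C.
Proof. by rewrite /mxdot linearD mulmxDl raddfD. Qed.

Lemma mxdotZr m n k (A B : 'M[R]_(m, n)) : mxdot A (k *: B) = k * mxdot A B.
Proof. by rewrite /mxdot -scalemxAr mxtraceZ. Qed.

Lemma mxdotZl m n k (A B : 'M[R]_(m, n)) : mxdot (k *: A) B = k * mxdot A B.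
Proof. by rewrite /mxdot linearZ -scalemxAl mxtraceZ. Qed.

Lemma mxdotNr m n (A B : 'M[R]_(m, n)) : mxdot A (- B) = - mxdot A B.
Proof. by rewrite -scaleN1r mxdotZr mulN1r. Qed.

Lemma mxdotNl m n (A B : 'M[R]_(m, n)) : mxdot (- A) B = - mxdot A B.
Proof. by rewrite -scaleN1r mxdotZl mulN1r. Qed.

Lemma mxdotC m n (A B : 'M[R]_(m, n)) : mxdot A B = mxdot B A.
Proof. by rewrite /mxdot -mxtrace_tr trmx_mul trmxK. Qed.

Lemma mxdot_cVE n (u v : 'cV[R]_n) : mxdot u v = \sum_i u i 0 * v i 0.
Proof.
rewrite /mxdot /mxtrace big_ord1 mxE.
by apply: eq_bigr => i _; rewrite mxE.
Qed.

Lemma mxdot_ge0 n (u : 'cV[R]_n) : 0 <= mxdot u u.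
Proof. by rewrite mxdot_cVE; apply: sumr_ge0 => i _; rewrite -expr2 sqr_ge0. Qed.

Lemma enorm_sqr n (u : 'cV[R]_n) : enorm u ^+ 2 = mxdot u u.
Proof. by rewrite sqr_sqrtr // mxdot_ge0. Qed.

Lemma enormZ n (k : R) (u : 'cV[R]_n) : enorm (k *: u) = `|k| * enorm u.
Proof.
by rewrite /enorm mxdotZl mxdotZr mulrA -expr2 sqrtrM ?sqr_ge0 // sqrtr_sqr.
Qed.

(** This follows from the Cauchy-Schwarz inequality, but expanding the
    nonnegative square of [u - k *: v] gives it at once. *)
Lemma mxdot_le_enorm n (k : R) (u v : 'cV[R]_n) :
  0 < k -> enorm u <= k * enorm v -> mxdot u v <= k * mxdot v v.
Proof.
move=> k0 uv.
have sq : mxdot u u <= k ^+ 2 * mxdot v v.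
  by rewrite -!enorm_sqr -exprMn lerXn2r ?nnegrE ?mulr_ge0 ?sqrtr_ge0 ?(ltW k0).
have := mxdot_ge0 (u - k *: v).
rewrite mxdotDl !mxdotDr !mxdotNl !mxdotNr !mxdotZl !mxdotZr (mxdotC v u) => ge0.
rewrite -(ler_pM2l k0); nra.
Qed.

Lemma mxdot_tens n (p : 'cV[R]_n) (H : 'M[R]_n) :
  mxdot (p *m p^T) H = mxdot p (H *m p).
Proof. by rewrite /mxdot trmx_mul trmxK -mulmxA mxtrace_mulC -mulmxA. Qed.

End DotProduct.

(** * Functions with a Lipschitz gradient *)

Section Descent.
Context {R : realType} {n : nat}.
Implicit Types (f : 'cV[R]_n.+1 -> R) (u v z d : 'cV[R]_n.+1).

Lemma derive_gradient f u d :
  differentiable f u -> 'D_d f u = mxdot (gradient f u) d.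
Proof.
move=> df; rewrite mxdot_cVE deriveE //.
rewrite {1}(matrix_sum_delta d) linear_sum; apply: eq_bigr => i _.
by rewrite big_ord1 linearZ mxE deriveE // mulrC.
Qed.

Lemma is_derive_line f z d (s : R) : differentiable f (z + s *: d) ->
  is_derive s 1 (fun r : R => f (z + r *: d))
    (mxdot (gradient f (z + s *: d)) d).
Proof.
move=> df; rewrite -derive_gradient //.
have dq (h : R) : f (z + (h *: (1 : R) + s) *: d) = f (h *: d + (z + s *: d)).
  by rewrite scalerDl addrCA [h *: 1]mulr1.
have dqE : (fun h : R => h^-1 *: (f (z + (h *: (1 : R) + s) *: d)
      - f (z + s *: d)))
    = (fun h : R => h^-1 *: (f (h *: d + (z + s *: d)) - f (z + s *: d))).
  by apply/funext => h; rewrite dq.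
by apply: DeriveDef; rewrite /derivable /derive /= dqE //; exact: diff_derivable.
Qed.

(** Along the segment from [z] to [z + d] the slope of [f] grows at most
    linearly with rate [nu * mxdot d d], so subtracting the corresponding
    parabola leaves a nonincreasing function of the parameter. The sign [e]
    makes the argument serve both [f] and [- f]. *)
Lemma descent_signed nu f z d (e : R) : 0 < nu -> C11 nu f -> e ^+ 2 = 1 ->
  e * (f (z + d) - f z - mxdot (gradient f z) d) <= nu / 2 * mxdot d d.
Proof.
move=> nu0 [df _ lip] e1.
pose g r := e * (f (z + r *: d) - r * mxdot (gradient f z) d)
  - nu / 2 * mxdot d d * r ^+ 2.
have dg (s : R) : is_derive s 1 g
   (e * (mxdot (gradient f (z + s *: d)) d - mxdot (gradient f z) d)
     - nu * mxdot d d * s).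
  have dl := is_derive_line (df (z + s *: d)).
  apply: is_derive_eq.
  by rewrite /GRing.scale /=; field.
have g10 : g 1 <= g 0.
  apply: (@ler0_derive1_le_cc _ g 0 1);
    rewrite ?in_itv /= ?lexx ?ler01 //.
  - move=> s; rewrite in_itv /= => /andP[s0 _].
    rewrite derive1E derive_val subr_le0 -mxdotNl -mxdotDl -mxdotZl.
    rewrite mulrAC; apply: mxdot_le_enorm; first exact: mulr_gt0.
    rewrite enormZ -sqrtr_sqr e1 sqrtr1 mul1r.
    apply: le_trans (lip _ _) _.
    by rewrite addrAC subrr add0r enormZ (gtr0_norm s0) mulrA.
  - apply: derivable_within_continuous => s _.
    exact: ex_derive.
move: g10; rewrite /g scale0r scale1r addr0; nra.
Qed.

Lemma descent nu f z u : 0 < nu -> C11 nu f ->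
  `|f u - f z - mxdot (gradient f z) (u - z)| <= nu / 2 * mxdot (u - z) (u - z).
Proof.
move=> nu0 fC.
have H := fun e => @descent_signed nu f z (u - z) e nu0 fC.
have /H : (1 : R) ^+ 2 = 1 by rewrite expr1n.
have /H : (-1 : R) ^+ 2 = 1 by rewrite sqrrN expr1n.
by rewrite (addrC z) subrK mulN1r mul1r => ? ?; rewrite ler_norml lerNl; apply/andP.
Qed.

(** The first-order terms at the interior point [z] cancel in the convex
    combination, and the two quadratic remainders add up to
    [t * (1 - t)] times the squared length of the segment. *)
Lemma segment_interpolation_error nu f u v (t : R) :
  0 < nu -> C11 nu f -> 0 <= t <= 1 ->
  `|t * f u + (1 - t) * f v - f (t *: u + (1 - t) *: v)|
    <= nu / 2 * (t * (1 - t)) * mxdot (u - v) (u - v).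
Proof.
move=> nu0 fC /andP[t0 t1]; set z := t *: u + _.
have uz : u - z = (1 - t) *: (u - v).
  by apply/matrixP => i j; rewrite !mxE; ring.
have vz : v - z = (- t) *: (u - v).
  by apply/matrixP => i j; rewrite !mxE; ring.
have := descent z v nu0 fC; have := descent z u nu0 fC.
rewrite uz vz !mxdotZl !mxdotZr !ler_norml.
move: (mxdot _ _) (mxdot _ _) (f u) (f v) (f z) => G D a b c.
move=> /andP[h1 h2] /andP[h3 h4].
have t1' : 0 <= 1 - t by rewrite subr_ge0.
have := ler_wpM2l t0 h1; have := ler_wpM2l t0 h2.
have := ler_wpM2l t1' h3; have := ler_wpM2l t1' h4.
by move=> k4 k3 k2 k1; apply/andP; split; nra.
Qed.

End Descent.

(** * Planar affine geometry *)

Section Plane.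
Context {R : realType}.
Implicit Types (u v w : 'cV[R]_2).

Lemma free_unitmx u v :
  free [:: u; v] -> (row_mx u v : 'M[R]_(1 + 1)) \in unitmx.
Proof.
move=> uv; rewrite -unitmx_tr -row_free_unit; apply: inj_row_free => k.
rewrite -(hsubmxK (k : 'rV[R]_(1 + 1))) tr_row_mx mul_row_col.
rewrite [lsubmx _]mx11_scalar [rsubmx _]mx11_scalar !mul_scalar_mx.
move=> /(congr1 trmx); rewrite linearD !linearZ /= !trmxK trmx0 => uv0.
have /freeP fr : free [tuple u; v] by [].
have := fr (tnth [tuple lsubmx k 0 0; rsubmx k 0 0]).
rewrite big_ord_recl big_ord1 /= => /(_ uv0) k0.
move: (k0 ord0) (k0 (lift ord0 ord0)); rewrite !(tnth_nth 0) /= => -> ->.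
by rewrite !raddf0 row_mx0.
Qed.

Lemma free_coord u v w : free [:: u; v] -> exists a b, w = a *: u + b *: v.
Proof.
move=> /free_unitmx uv.
pose c : 'cV[R]_(1 + 1) := invmx (row_mx u v : 'M[R]_(1 + 1)) *m w.
exists (usubmx c 0 0), (dsubmx c 0 0).
rewrite -!mul_mx_scalar -!mx11_scalar -mul_row_col vsubmxK.
by rewrite /c mulKVmx.
Qed.

Lemma affine_function_comb (g : 'cV[R]_2 -> R) u v w (a b : R) :
  affine_function g ->
  g (u + (a *: (v - u) + b *: (w - u))) = (1 - a - b) * g u + a * g v + b * g w.
Proof.
move=> [c [k gE]]; rewrite !gE !(mxdotDr, mxdotZr, mxdotNr); ring.
Qed.

End Plane.

(** * The error bound *)

(** The values of the Lagrange polynomials at [x 0] are its barycentric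
    coordinates: these exist by affine independence, and evaluating an affine
    function through them identifies them. *)
Lemma lagrange_coordinates (R : realType) (x : 'I_4 -> 'cV[R]_2)
    (ell : 'I_4 -> 'cV[R]_2 -> R) :
  affinely_independent x -> lagrange_family x ell ->
  [/\ x 0 = x 1 + (ell 2 (x 0) *: (x 2 - x 1) + ell 3 (x 0) *: (x 3 - x 1)),
      ell 1 (x 0) = 1 - ell 2 (x 0) - ell 3 (x 0)
    & forall g, affine_function g ->
      g (x 0) = ell 1 (x 0) * g (x 1) + ell 2 (x 0) * g (x 2)
                + ell 3 (x 0) * g (x 3)].
Proof.
move=> ind [_ lag].
have [a [b ab]] := free_coord (x 0 - x 1) ind.
have x0E : x 0 = x 1 + (a *: (x 2 - x 1) + b *: (x 3 - x 1)).
  by rewrite -ab addrC subrK.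
have ev g (ga : affine_function g) :
    g (x 0) = (1 - a - b) * g (x 1) + a * g (x 2) + b * g (x 3).
  by rewrite x0E affine_function_comb.
have [a1 l1] := lag 1 isT; have [a2 l2] := lag 2 isT.
have [a3 l3] := lag 3 isT.
have e1 : ell 1 (x 0) = 1 - a - b.
  by rewrite ev // !l1 //= !mulr0 !addr0 mulr1.
have e2 : ell 2 (x 0) = a.
  by rewrite ev // !l2 //= !mulr0 !addr0 add0r mulr1.
have e3 : ell 3 (x 0) = b.
  by rewrite ev // !l3 //= !mulr0 !add0r mulr1.
by rewrite e1 e2 e3; split.
Qed.

Section Quadrilateral.
Context {R : realType} (x : 'I_4 -> 'cV[R]_2) (ell : 'I_4 -> 'cV[R]_2 -> R).
Context (x_indep : affinely_independent x).
Context (ell_lagrange : lagrange_family x ell).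
Local Notation l1 := (ell 1 (x 0)).
Local Notation l2 := (ell 2 (x 0)).
Local Notation l3 := (ell 3 (x 0)).
Local Notation p := (x 2 - x 0).
Local Notation q := (x 1 - x 3).

(** The weights [ell i (x 0)] have zero sum and zero first moment, so the
    second moment [G] does not change when the origin is moved to the common
    point of the line through [x 0] and [x 2], directed by [p], and the line
    through [x 1] and [x 3], directed by [q]. Seen from there every [x i] is a
    multiple of [p] or of [q], hence no mixed term occurs. *)
Lemma Gmx_diag : l2 != 1 ->
  Gmx x ell = (l2 / (1 - l2)) *: (p *m p^T) + (l1 * l3 / (1 - l2)) *: (q *m q^T).
Proof.
move=> l2n1; have nz : 1 - l2 != 0 by rewrite subr_eq0 eq_sym.
have [x0E l1E _] := lagrange_coordinates x_indep ell_lagrange.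
have [ell0 _] := ell_lagrange.
rewrite /Gmx !big_ord_recl big_ord0 addr0.
have -> : lift ord0 ord0 = 1 :> 'I_4 by apply/val_inj.
have -> : lift ord0 (lift ord0 ord0) = 2 :> 'I_4 by apply/val_inj.
have -> : lift ord0 (lift ord0 (lift ord0 ord0)) = 3 :> 'I_4 by apply/val_inj.
rewrite ell0 l1E.
have x0e i : x 0 i 0 = x 1 i 0 + (l2 * (x 2 i 0 - x 1 i 0)
    + l3 * (x 3 i 0 - x 1 i 0)) by rewrite {1}x0E !mxE.
move: l2 l3 nz x0e => a b nz x0e.
by apply/matrixP => i j; rewrite !mxE !big_ord1 !mxE !x0e; field.
Qed.

(** Over the basis [x 2 - x 1], [x 3 - x 1] the two columns have triangular
    coordinates, with diagonal entries [1 - l2] and [-1]. *)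
Lemma Ptilde_unitmx : l2 != 1 -> Ptilde x \in unitmx.
Proof.
move=> l2n1; have nz : 1 - l2 != 0 by rewrite subr_eq0 eq_sym.
have [x0E _ _] := lagrange_coordinates x_indep ell_lagrange.
pose T : 'M[R]_(1 + 1) := block_mx (1 - l2)%:M 0 (- l3)%:M (- 1)%:M.
have -> : Ptilde x = row_mx (x 2 - x 1) (x 3 - x 1) *m T.
  have pE : p = (x 2 - x 1) *m (1 - l2)%:M + (x 3 - x 1) *m (- l3)%:M.
    rewrite !mul_mx_scalar {1}x0E.
    by apply/matrixP => i j; rewrite !mxE; ring.
  have qE : q = (x 2 - x 1) *m 0 + (x 3 - x 1) *m (- 1)%:M.
    by rewrite mulmx0 add0r mul_mx_scalar scaleN1r opprB.
  by rewrite /Ptilde pE qE -mul_row_block.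
have Tu : T \in unitmx.
  rewrite unitmxE det_lblock !det_scalar1.
  by rewrite unitfE mulf_neq0 // oppr_eq0 oner_eq0.
by rewrite unitmx_mul free_unitmx.
Qed.

Lemma Htilde_eigen nu : l2 != 1 ->
  Htilde nu x *m p = nu *: p /\ Htilde nu x *m q = - nu *: q.
Proof.
move=> /Ptilde_unitmx Pu.
have PD : row_mx p q *m (block_mx nu%:M 0 0 (- nu)%:M : 'M[R]_(1 + 1)) =
    row_mx (nu *: p) (- nu *: q).
  by rewrite mul_row_block !mulmx0 addr0 add0r !mul_mx_scalar.
have HP : Htilde nu x *m Ptilde x = row_mx (nu *: p) (- nu *: q).
  by rewrite /Htilde mulmxKV // -PD.
by apply: eq_row_mx; rewrite -mul_mx_row.
Qed.

Lemma Gmx_Htilde nu : l2 != 1 ->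
  mxdot (Gmx x ell) (Htilde nu x) =
  nu * (l2 * mxdot p p - l1 * l3 * mxdot q q) / (1 - l2).
Proof.
move=> l2n1; have nz : 1 - l2 != 0 by rewrite subr_eq0 eq_sym.
have [Hp Hq] := Htilde_eigen nu l2n1.
rewrite Gmx_diag // [LHS]mxdotDl !mxdotZl !mxdot_tens Hp Hq !mxdotZr.
by field.
Qed.

(** With [d] the dot product at the obtuse angle and [e] the side from [x 1]
    to [x 3], the last hypothesis reads [(1 - l2) * d < l3 * mxdot e e], that
    is, [p] and [q] form an acute angle. Its right-hand side is not positive
    and [d] is negative, which forces [0 < 1 - l2 = l1 + l3]. *)
Lemma region_signs :
  mxdot (x 2 - x 1) (x 3 - x 1) < 0 -> l3 < 0 ->
  l1 * mxdot (x 2 - x 1) (x 3 - x 1) - l3 * mxdot (x 2 - x 3) (x 1 - x 3) < 0 ->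
  0 < l1 /\ l2 < 1.
Proof.
have [_ l1E _] := lagrange_coordinates x_indep ell_lagrange.
have -> : mxdot (x 2 - x 3) (x 1 - x 3) =
    mxdot (x 3 - x 1) (x 3 - x 1) - mxdot (x 2 - x 1) (x 3 - x 1).
  by rewrite !(mxdotDl, mxdotDr, mxdotNl, mxdotNr); ring.
have := mxdot_ge0 (x 3 - x 1); rewrite l1E.
move: (mxdot _ _) (mxdot _ _) => e d e0 d0 l30 reg.
have : 0 < 1 - l2.
  rewrite ltNge; apply/negP => h; nra.
by move=> h; split; lra.
Qed.

End Quadrilateral.

Theorem theorem6p4 (R : realType) (nu : R) (f fhat : 'cV[R]_2 -> R)
    (x : 'I_4 -> 'cV[R]_2) (ell : 'I_4 -> 'cV[R]_2 -> R)
    (nu_gt0 : 0 < nu)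
    (f_C11 : C11 nu f)
    (x_indep : affinely_independent x)
    (x_obtuse : mxdot (x 2 - x 1) (x 3 - x 1) < 0)
    (fhat_interp : affine_interpolant x f fhat)
    (ell_lagrange : lagrange_family x ell)
    (ell2_gt0 : 0 < ell 2 (x 0))
    (ell3_lt0 : ell 3 (x 0) < 0)
    (x0_region :
       ell 1 (x 0) * mxdot (x 2 - x 1) (x 3 - x 1)
       - ell 3 (x 0) * mxdot (x 2 - x 3) (x 1 - x 3) < 0) :
  `|fhat (x 0) - f (x 0)| <= 1 / 2 * mxdot (Gmx x ell) (Htilde nu x).
Proof.
have [l1_gt0 l2_lt1] :=
  region_signs x_indep ell_lagrange x_obtuse ell3_lt0 x0_region.
have [x0E l1E interp] := lagrange_coordinates x_indep ell_lagrange.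
have [fhat_aff fhatE] := fhat_interp.
rewrite Gmx_Htilde ?lt_eqF // interp // !fhatE //.
move: x0E l1E l1_gt0 l2_lt1 ell2_gt0 ell3_lt0.
move: (ell 1 (x 0)) (ell 2 (x 0)) (ell 3 (x 0)) => a b c.
move=> x0E aE a0 b1 b0 c0.
have nz1 : 1 - b != 0 by rewrite subr_eq0 gt_eqF.
have nza : a != 0 by rewrite gt_eqF.
(* The common point of the lines carrying the sides x0 x2 and x1 x3. *)
pose w := (1 - b)^-1 *: (x 0 - b *: x 2).
have x0w : b *: x 2 + (1 - b) *: w = x 0.
  by rewrite /w scalerA mulfV // scale1r addrC subrK.
have x2w : x 2 - w = (1 - b)^-1 *: (x 2 - x 0).
  by rewrite /w; apply/matrixP => i j; rewrite !mxE; field.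
have x0e i j : x 0 i j = x 1 i j + (b * (x 2 i j - x 1 i j)
    + c * (x 3 i j - x 1 i j)) by rewrite {1}x0E !mxE.
have nza' : 1 - b - c != 0 by rewrite -aE.
have x1w : (- c / a) *: x 3 + (1 - - c / a) *: w = x 1.
  rewrite /w aE; apply/matrixP => i j; rewrite !mxE x0e.
  by field; rewrite nz1 nza'.
have x3w : x 3 - w = (- a / (1 - b)) *: (x 1 - x 3).
  rewrite /w aE; apply/matrixP => i j; rewrite !mxE x0e.
  by field.
have bb : 0 <= b <= 1 by rewrite !ltW.
have cc : 0 <= - c / a <= 1.
  by rewrite divr_ge0 ?ler_pdivrMr ?oppr_ge0 ?mul1r; lra.
have := segment_interpolation_error (x 2) w nu_gt0 f_C11 bb.
have := segment_interpolation_error (x 3) w nu_gt0 f_C11 cc.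
rewrite x0w x1w x2w x3w !mxdotZl !mxdotZr => e1 e0.
(* The value of f at w cancels because 1 - b = a + c. *)
have -> : a * f (x 1) + b * f (x 2) + c * f (x 3) - f (x 0) =
   (b * f (x 2) + (1 - b) * f w - f (x 0))
   - a * (- c / a * f (x 3) + (1 - - c / a) * f w - f (x 1)).
  by rewrite aE; field.
apply: le_trans (ler_normB _ _) _; rewrite normrM gtr0_norm //.
apply: le_trans (lerD e0 (ler_wpM2l (ltW a0) e1)) _.
by rewrite le_eqVlt; apply/orP; left; apply/eqP; rewrite !aE; field;
  rewrite nz1 nza'.
Qed.
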